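(* Consider the invertible Bloom filter described in the context, with constant factors in $m=O(d\log(1/\epsilon))$ and $k=\Theta(\log(1/\epsilon))$ suitably chosen, and let $0<\epsilon<1/4$. Suppose an arbitrary sequence of Insert and Delete operations (deletions possibly of items never inserted) has been performed, and the number of identifiers $x$ with nonzero net count (items inserted but not deleted, plus false items deleted but not inserted) is at most $d$. Then, with probability at least $1-\epsilon$ over the random hash functions, the ListStragglers procedure answers correctly, i.e., it recovers all identifiers with nonzero net count, outputting exactly those with positive net count.
   Context: Identifiers are integers in $[0,n]$; $d\ll n$ and $\epsilon>0$ are parameters. The invertible Bloom filter consists of a global signed counter count (initially 0), a table $B$ of $m=O(d\log(1/\epsilon))$ cells and a table $C$ of the same number of cells, each cell having a signed integer field count, an idSum field and a hashSum field (all initially 0; the sums may overflow but addition and subtraction remain mutual inverses). It uses independent fully random hash functions $h_1,\dots,h_k$ ($k=\Theta(\log(1/\epsilon))$) mapping identifiers to cells of $B$, $f_1,f_2$ mapping identifiers to cells of $C$, and $g:[0,n]\to[0,n^2]$. Insert $x$: increment the global count; for each $i=1..k$, increment $B[h_i(x)].$count, add $x$ to $B[h_i(x)].$idSum, add $g(x)$ to $B[h_i(x)].$hashSum; do the same for $C[f_1(x)]$ and $C[f_2(x)]$. Delete $x$: the same with decrements and subtractions. The net count of identifier $x$ is (#inserts of $x$) $-$ (#deletes of $x$). ListStragglers: (first while loop) while some cell $B[i]$ satisfies $g(B[i].\mathrm{idSum}/B[i].\mathrm{count})=B[i].\mathrm{hashSum}/B[i].\mathrm{count}$, let $x=B[i].\mathrm{idSum}/B[i].\mathrm{count}$;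 if $B[i].\mathrm{count}>0$, push $x$ onto an output stack and delete $B[i].\mathrm{count}$ copies of $x$ from $B$ and $C$ (as in Delete); otherwise insert $-B[i].\mathrm{count}$ copies of $x$ into $B$ and $C$ (as in Insert). After this loop, if the global count is 0, output the stack; otherwise run the same while loop using the cells of $C$ instead of $B$, then output the stack (finally re-inserting output elements into $B$ and $C$).
   Formalization: ''d ≪ n'' is made precise as d·ln(1/ε) ≤ δ·ε·n² with d ≥ 1 and an absolute δ > 0; and in each while loop, passing cells to which x is hashed exactly once are treated before other passing cells, since with an arbitrary choice of cell the procedure can loop forever or output wrongly. *)

(* Defs.v *)
From HB Require Import structures.
From mathcomp Require Import all_boot all_order all_algebra.
From mathcomp Require Import boolp reals exp.

Set Implicit Arguments.
Unset Strict Implicit.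
Unset Printing Implicit Defensive.

Import Order.TTheory GRing.Theory Num.Theory.
Local Open Scope ring_scope.

Definition ident (n : nat) := 'I_n.+1.

Definition hash_fun (n m : nat) := {ffun ident n -> 'I_m}.

(* The three independent components are (h_1, ..., h_k), (f_1, f_2) and g;
   under the uniform distribution on this finite type all these functions are
   independent and fully random. *)
Definition hashes (n m k : nat) : finType :=
  ({ffun 'I_k -> hash_fun n m} * {ffun 'I_2 -> hash_fun n m}
   * {ffun ident n -> 'I_(n ^ 2).+1})%type.

Definition hashB n m k (w : hashes n m k) : {ffun 'I_k -> hash_fun n m} :=
  w.1.1.
Definition hashC n m k (w : hashes n m k) : {ffun 'I_2 -> hash_fun n m} :=
  w.1.2.
Definition hashg n m k (w : hashes n m k) : {ffun ident n -> 'I_(n ^ 2).+1} :=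
  w.2.

Definition Pr (R : realType) (T : finType) (P : T -> Prop) : R :=
  #|[set w : T | `[< P w >]]|%:R / #|T|%:R.

Record cell := Cell { cell_count : int; cell_idSum : int; cell_hashSum : int }.

Definition empty_cell := Cell 0 0 0.

Definition table (m : nat) := {ffun 'I_m -> cell}.

Record ibf (m : nat) := IBF { total_count : int; tabB : table m; tabC : table m }.

Definition empty_ibf (m : nat) : ibf m :=
  IBF 0 [ffun=> empty_cell] [ffun=> empty_cell].

Section Operations.
Variables (n m k : nat) (w : hashes n m k).

Definition add_cell (s : int) (x : ident n) (c : cell) : cell :=
  Cell (cell_count c + s) (cell_idSum c + s * (x : nat)%:Z)
       (cell_hashSum c + s * (hashg w x : nat)%:Z).

Definition add_at (s : int) (x : ident n) (T : table m) (i : 'I_m) : table m :=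
  [ffun j => if j == i then add_cell s x (T j) else T j].

(* If x is hashed several times to the same cell, that cell is updated once for
   each of the hash functions. *)
Definition add_table (r : nat) (hs : {ffun 'I_r -> hash_fun n m}) (s : int)
    (x : ident n) (T : table m) : table m :=
  foldl (fun T' l => add_at s x T' (hs l x)) T (enum 'I_r).

Definition add_ibf (s : int) (x : ident n) (b : ibf m) : ibf m :=
  IBF (total_count b + s) (add_table (hashB w) s x (tabB b))
      (add_table (hashC w) s x (tabC b)).

Definition insert : ident n -> ibf m -> ibf m := add_ibf 1.
Definition delete : ident n -> ibf m -> ibf m := add_ibf (-1).

End Operations.

Inductive op (n : nat) := Insert of ident n | Delete of ident n.

Definition net n (ops : seq (op n)) (x : ident n) : int :=
  (count (fun o => if o is Insert y then y == x else false) ops)%:Z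
  - (count (fun o => if o is Delete y then y == x else false) ops)%:Z.

Definition apply_op n m k (w : hashes n m k) (b : ibf m) (o : op n) : ibf m :=
  match o with Insert x => insert w x b | Delete x => delete w x b end.

Definition run n m k (w : hashes n m k) (ops : seq (op n)) : ibf m :=
  foldl (apply_op w) (empty_ibf m) ops.

(* Total correctness of the nondeterministic loop that performs [step] as long
   as it can: every execution from s terminates, in a state satisfying Q. *)
Inductive ensures (S : Type) (step : S -> S -> Prop) (Q : S -> Prop) (s : S) :
    Prop :=
  Ensures of ((forall s', ~ step s s') -> Q s)
           & (forall s', step s s' -> ensures step Q s').

(* [recovered] is a ghost log of the identifiers x treated by the iterations,
   including those with a negative count, which are not pushed on [stack]. *)
Record lstate (n m : nat) :=
  LState { bloom : ibf m; stack : seq (ident n); recovered : seq (ident n) }.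

Section ListStragglers.
Variables (n m k : nat) (w : hashes n m k).

(* idSum / count is the identifier x and g(x) = hashSum / count; the divisions
   are exact, and g is defined on identifiers only. *)
Definition passes (c : cell) (x : ident n) : bool :=
  [&& cell_count c != 0,
      (cell_idSum c)%:~R / (cell_count c)%:~R == (x : nat)%:R :> rat
    & (cell_hashSum c)%:~R / (cell_count c)%:~R == (hashg w x : nat)%:R :> rat].

Definition extract (x : ident n) (c : int) (s : lstate n m) : lstate n m :=
  if 0 < c then
    LState (iter `|c|%N (delete w x) (bloom s)) (x :: stack s)
           (x :: recovered s)
  else
    LState (iter `|c|%N (insert w x) (bloom s)) (stack s) (x :: recovered s).

Definition mult (r : nat) (hs : {ffun 'I_r -> hash_fun n m}) (i : 'I_m)
    (x : ident n) : nat :=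
  #|[set l : 'I_r | hs l x == i]|.

(* Any cell that passes the test may be treated, except that cells to which x is
   hashed exactly once go first.  If x, of net count c, is alone in a cell to
   which it is hashed j > 1 times, the count of that cell is j * c, and deleting
   j * c copies of x leaves x with net count (1 - j) * c; treating such cells
   first can loop forever, or push an x with c < 0. *)
Definition step (r : nat) (hs : {ffun 'I_r -> hash_fun n m})
    (tab : ibf m -> table m) (s s' : lstate n m) : Prop :=
  exists (i : 'I_m) (x : ident n),
    [/\ passes (tab (bloom s) i) x,
        mult hs i x = 1%N \/
        (forall i' x', passes (tab (bloom s) i') x' -> mult hs i' x' <> 1%N)
      & s' = extract x (cell_count (tab (bloom s) i)) s].

Definition list_stragglers_ensures (Q : lstate n m -> Prop) (b : ibf m) : Prop :=
  ensures (step (hashB w) (@tabB m))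
    (fun s => if total_count (bloom s) == 0 then Q s
              else ensures (step (hashC w) (@tabC m)) Q s)
    (LState b [::] [::]).

Definition answers_correctly (ops : seq (op n)) : Prop :=
  list_stragglers_ensures
    (fun s => recovered s =i [set x | net ops x != 0] /\
              perm_eq (stack s) (enum [set x | 0 < net ops x]))
    (run w ops).

End ListStragglers.

Definition table_size (R : realType) (cm : R) (d : nat) (eps : R) : nat :=
  `|Num.ceil (cm * d%:R * ln (eps^-1))|%N.

Definition hash_number (R : realType) (ck eps : R) : nat :=
  `|Num.ceil (ck * ln (eps^-1))|%N.

(* Main.v *)
Require Import Defs.
From mathcomp Require Import all_boot all_order all_algebra.
From mathcomp Require Import boolp reals sequences exp.
From mathcomp Require Import zify ring lra.

(* Table B alone recovers everything with probability 1 - eps, so the second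
   loop is never needed.  View the k hashes of an identifier as k balls thrown
   into the m cells of B.  Two events suffice.
   (1) Every nonempty set T of stragglers has a cell containing exactly one ball
   of T.  If this fails for |T| = j, the jk balls occupy at most jk / 2 cells,
   so half of them fall into cells occupied by a set of representatives of the
   others; a union bound over the representatives gives probability at most
   (8 j k / m) ^ (j (k / 2)), which beats the number of sets T of size j once
   m >= C d k.
   (2) No cell holding balls of two identifiers passes the test, whatever subset
   V of its balls is left.  For a fixed cell and V, the balls of V all land in
   the cell with probability m ^ - |V|, and the linear equation expressing that
   the test is passed determines one value of g, so it holds with probability
   at most 1 / (n ^ 2 + 1); summing gives m (1 + 1 / m) ^ (d k) / (n ^ 2 + 1).
   Since all subsets V are covered, the order of the extractions does not
   matter. *)

Set Implicit Arguments.
Unset Strict Implicit.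
Unset Printing Implicit Defensive.

Import Order.TTheory GRing.Theory Num.Theory.
Local Open Scope ring_scope.

(** * Counting maps *)

Section Counting.
Local Open Scope nat_scope.
Variables J A : finType.
Implicit Types (f : {ffun J -> A}) (E D R : {set J}).

Definition upd f (y : J) (a : A) : {ffun J -> A} :=
  [ffun z => if z == y then a else f z].

(** Resampling the value at [y]: exchanging [a] with [f y] is an involution on the pairs [(f, a)],
    so [upd f y a] hits every map exactly [#|A|] times. *)
Lemma card_mul_upd (P : {set {ffun J -> A}}) (y : J) :
  #|P| * #|A| = \sum_f #|[set a | upd f y a \in P]|.
Proof.
transitivity (\sum_f \sum_a (upd f y a \in P : nat)); last first.
  apply: eq_bigr => f _; rewrite -sum1_card [RHS]big_mkcond /=.
  by apply: eq_bigr => a _; rewrite inE; case: (_ \in _).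
rewrite pair_big /=.
pose swap (p : {ffun J -> A} * A) := (upd p.1 y p.2, p.1 y).
have swapK : involutive swap.
  move=> [f a]; rewrite /swap /=; congr pair; last by rewrite ffunE eqxx.
  by apply/ffunP => z; rewrite !ffunE; case: eqP => // ->.
rewrite (reindex_inj (inv_inj swapK)) /=.
transitivity (\sum_(p : {ffun J -> A} * A) (p.1 \in P : nat)).
  rewrite -(pair_big predT predT (fun f (_ : A) => (f \in P : nat))) /=.
  rewrite -(sum1_card (mem P)) big_distrl /= big_mkcond /=.
  by apply: eq_bigr => f _; rewrite sum_nat_const; case: (_ \in _);
    rewrite ?mul1n ?muln1 ?muln0.
apply: eq_bigr => -[f a] _ /=; congr (nat_of_bool (_ \in P)).
by apply/ffunP => z; rewrite !ffunE; case: eqP => // ->.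
Qed.

(** Once the values off [y] are fixed, at most one value at [y] is admissible, so the event has
    probability at most [1 / #|A|]. *)
Lemma card_mul_le_determined (P : {set {ffun J -> A}}) (y : J) :
  (forall f a b, upd f y a \in P -> upd f y b \in P -> a = b) ->
  #|P| * #|A| <= #|{ffun J -> A}|.
Proof.
move=> det; rewrite (card_mul_upd P y) -sum1_card leq_sum // => f _.
by apply/card_le1_eqP => a b; rewrite !inE => aP bP; apply: det bP aP.
Qed.

(** The points of [E] are exposed one at a time. Since [B f] does not react to changes on [E], each
    of them falls into it with probability at most [c / #|A|], although [B f] may depend on the
    other values of [f]. *)
Lemma card_confined (B : {ffun J -> A} -> {set A}) E (c : nat) :
    (forall f, #|B f| <= c) ->
    (forall f y a, y \in E -> B (upd f y a) = B f) ->
  #|[set f : {ffun J -> A} | [forall y in E, f y \in B f]]| * #|A| ^ #|E|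
    <= #|{ffun J -> A}| * c ^ #|E|.
Proof.
move=> Bc; move: {2}#|E| (erefl #|E|) => e; elim: e E => [|e IH] E cE BE.
  by rewrite cE !expn0 !muln1 max_card.
have [y yE] : exists y, y \in E by apply/card_gt0P; rewrite cE.
have cE' : #|E :\ y| = e by move: cE; rewrite (cardsD1 y) yE => -[].
have BE' f z a : z \in E :\ y -> B (upd f z a) = B f.
  by rewrite inE => /andP[_ zE]; apply: BE.
have := IH _ cE' BE'; rewrite cE cE' => {}IH.
set P := [set f : {ffun _ -> _} | [forall y in E, _]].
set P' := [set f : {ffun _ -> _} | _] in IH.
have step : #|P| * #|A| <= #|P'| * c.
  rewrite (card_mul_upd P y) -sum_nat_const [leqRHS]big_mkcond /=.
  apply: leq_sum => f _.
  have sub : [set a | upd f y a \in P] \subset (if f \in P' then B f else set0).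
    apply/subsetP => a; rewrite !inE => /forall_inP H.
    have -> : [forall z in E :\ y, f z \in B f].
      apply/forall_inP => z; rewrite !inE => /andP[zy zE].
      by have := H z zE; rewrite BE // ffunE (negbTE zy).
    by have := H y yE; rewrite BE // ffunE eqxx.
  apply: leq_trans (subset_leq_card sub) _.
  by case: ifP => _; rewrite ?cards0.
rewrite !expnS mulnA; apply: leq_trans (leq_mul step (leqnn _)) _.
by rewrite mulnAC [leqRHS]mulnCA mulnC leq_mul2l IH orbT.
Qed.

Lemma exists_representatives f D :
  exists2 R : {set J}, R \subset D & f @: D \subset f @: R /\ #|R| <= #|f @: D|.
Proof.
have [->|[p0 p0D]] := set_0Vmem D; first by exists set0;
  rewrite ?imset0 ?sub0set ?cards0.
pose r a := odflt p0 [pick p in D | f p == a].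
have rP p : p \in D -> r (f p) \in D /\ f (r (f p)) = f p.
  move=> pD; rewrite /r; case: pickP => [q /andP[qD /eqP]//|/(_ p)].
  by rewrite pD eqxx.
exists (r @: (f @: D)); last first.
  split; last exact: leq_imset_card.
  apply/subsetP => _ /imsetP[p pD ->]; have [_ <-] := rP p pD.
  by apply: imset_f; apply: imset_f; apply: imset_f.
by apply/subsetP => _ /imsetP[_ /imsetP[p pD ->] ->]; case: (rP p pD).
Qed.

Lemma card_imset_no_singleton f D :
  (forall a, #|[set p in D | f p == a]| != 1) -> 2 * #|f @: D| <= #|D|.
Proof.
move=> H; rewrite -[leqRHS]sum1_card (partition_big_imset f) /=.
rewrite mulnC -sum_nat_const leq_sum // => _ /imsetP[p pD ->].
rewrite sum1dep_card; have := H (f p).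
have : 0 < #|[set q in D | f q == f p]|.
  by apply/card_gt0P; exists p; rewrite inE pD eqxx.
lia.
Qed.

Definition unpeelable D : {set {ffun J -> A}} :=
  [set f : {ffun J -> A} | [forall a, #|[set p in D | f p == a]| != 1]].

(* A map without singleton fibres on [D] has at most [#|D| / 2] values, so at
   least half of the elements of [D] fall into the image of a set [R] of
   representatives. *)
Lemma unpeelable_sub D :
  unpeelable D \subset \bigcup_(R in powerset D | 2 * #|R| <= #|D|)
     [set f : {ffun J -> A} | [forall y in D :\: R, f y \in f @: R]].
Proof.
apply/subsetP => f; rewrite inE => /forallP H.
have [R RD [fR cR]] := exists_representatives f D.
apply/bigcupP; exists R.
  rewrite powersetE RD /=; have := card_imset_no_singleton H.
  by apply: leq_trans; rewrite leq_mul2l cR orbT.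
rewrite inE; apply/forall_inP => y; rewrite inE => /andP[_ yD].
exact: subsetP fR _ (imset_f f yD).
Qed.

(** Union bound over the at most [2 ^ #|D|] sets [R] of representatives: at least [b] points lie in
    [D :\: R], and each is confined to the image of [R], of size at most [#|D|]. *)
Lemma card_unpeelable D (b : nat) : 2 * b <= #|D| -> #|D| <= #|A| ->
  #|unpeelable D| * #|A| ^ b <= #|{ffun J -> A}| * (2 ^ #|D| * #|D| ^ b).
Proof.
move=> bD DA; have [D0|D0] := posnP #|D|.
  have -> : b = 0 by lia.
  by rewrite D0 !muln1 max_card.
apply: leq_trans (leq_mul (subset_leq_card (unpeelable_sub D)) (leqnn _)) _.
have bigle (P : pred {set J}) (F : {set J} -> {set {ffun J -> A}}) :
  #|\bigcup_(R | P R) F R| <= \sum_(R | P R) #|F R|.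
  elim/big_rec2: _ => [|R x y _ IH]; first by rewrite cards0.
  by apply: leq_trans (leq_card_setU _ _) _; rewrite leq_add2l.
apply: leq_trans (leq_mul (bigle _ _) (leqnn _)) _.
rewrite big_distrl /=.
apply: (@leq_trans (\sum_(R in powerset D) #|{ffun J -> A}| * #|D| ^ b)).
  rewrite big_mkcondr /=; apply: leq_sum => R; rewrite powersetE => RD.
  case: ifP => // cR; rewrite -/(expn _ _).
  have cDR : #|D :\: R| = #|D| - #|R| by rewrite cardsD (setIidPr RD).
  have bDR : b <= #|D :\: R| by lia.
  have := @card_confined (fun f => f @: R) (D :\: R) #|D|.
  rewrite -(subnKC bDR) !expnD => H.
  (* Only [b] of the [#|D :\: R|] factors [#|D| / #|A|] are kept; the others are at most 1 by
     [DA]. *)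
  have A0 : 0 < #|A| ^ (#|D :\: R| - b) by rewrite expn_gt0; lia.
  rewrite -(leq_pmul2r A0) -mulnA; apply: leq_trans (H _ _) _.
  - by move=> f; apply: leq_trans (leq_imset_card _ _) (subset_leq_card RD).
  - move=> f y a; rewrite inE => /andP[yR _].
    apply/eq_in_imset => z zR; rewrite ffunE; case: eqP => // zy.
    by rewrite -zy zR in yR.
  rewrite mulnA leq_mul2l; case: (_ - b) => [|e]; first by rewrite orbT.
  by rewrite leq_exp2r // DA orbT.
by rewrite sum_nat_const card_powerset mulnCA.
Qed.

End Counting.

(** * Peeling the filter *)

Section Peeling.
Variables (n m k : nat) (w : hashes n m k).
Implicit Types (u v : ident n -> int) (T : table m) (S : {set ident n}).

(** The contents of a cell of [B] as a linear function of the net counts, which forgets the order of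
    the operations. *)
Definition cell_of u (i : 'I_m) : cell :=
  Cell (\sum_x u x * (mult (hashB w) i x)%:Z)
       (\sum_x u x * (mult (hashB w) i x)%:Z * (x : nat)%:Z)
       (\sum_x u x * (mult (hashB w) i x)%:Z * (hashg w x : nat)%:Z).

Lemma foldl_add_at (r : nat) (hs : {ffun 'I_r -> hash_fun n m}) s x ls T i :
  foldl (fun T' l => add_at w s x T' (hs l x)) T ls i =
  add_cell w (s * (count (fun l => hs l x == i) ls)%:Z) x (T i).
Proof.
elim: ls T => [|l ls IH] T /=.
  by rewrite mulr0 /add_cell; case: (T i) => a b c /=; rewrite !mul0r !addr0.
rewrite IH ffunE eq_sym; case: eqP => _; last by rewrite add0n.
by rewrite /add_cell /= PoszD; congr Cell; ring.
Qed.

Lemma eq_cell_of u v : u =1 v -> cell_of u =1 cell_of v.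
Proof. by move=> uv i; rewrite /cell_of; congr Cell; apply: eq_bigr => x _;
  rewrite uv. Qed.

Lemma add_table_cell_of s x u T :
  T =1 cell_of u ->
  add_table w (hashB w) s x T =1 cell_of (fun y => u y + s *+ (y == x)).
Proof.
move=> Tu i; rewrite /add_table foldl_add_at Tu.
have -> : count (fun l => hashB w l x == i) (enum 'I_k) = mult (hashB w) i x.
  by rewrite /mult cardsE cardE -size_filter enumT.
rewrite /cell_of /add_cell /=; congr Cell;
  rewrite (bigD1 x) //= [RHS](bigD1 x) //=;
  rewrite eqxx mulr1n -addrA [X in _ + X]addrC addrA.
all: under [in RHS]eq_bigr => y /negbTE -> do rewrite mulr0n addr0.
all: by congr (_ + _); ring.
Qed.

(** Covers what the first loop reads and the total count that decides whether the second loop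
    runs. *)
Definition represents u (b : ibf m) :=
  total_count b = \sum_x u x /\ tabB b =1 cell_of u.

Lemma sum_add_delta s x u :
  \sum_y (u y + s *+ (y == x)) = \sum_y u y + s :> int.
Proof.
rewrite big_split /=; congr (_ + _).
by rewrite (bigD1 x) //= eqxx big1 ?addr0 // => y /negbTE ->.
Qed.

Lemma represents_add s x u b :
  represents u b -> represents (fun y => u y + s *+ (y == x)) (add_ibf w s x b).
Proof.
move=> [tu Tu]; split; first by rewrite sum_add_delta /= tu.
exact: add_table_cell_of.
Qed.

Lemma represents_ext u v b : u =1 v -> represents u b -> represents v b.
Proof.
move=> uv [tu Tu]; split; first by rewrite tu; apply: eq_bigr.
by move=> i; rewrite Tu; apply: eq_cell_of.
Qed.

Lemma represents_iter c s x u b :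
  represents u b ->
  represents (fun y => u y + (s *+ c) *+ (y == x)) (iter c (add_ibf w s x) b).
Proof.
move=> ub; elim: c => [|c IH] /=.
  by apply: represents_ext ub => y; rewrite mulr0n mul0rn addr0.
apply: represents_ext (represents_add _ _ IH) => y.
by rewrite -addrA -mulrnDl mulrSr.
Qed.

Lemma represents_run ops : represents (net ops) (run w ops).
Proof.
elim/last_ind: ops => [|ops o IH].
  split; first by rewrite big1.
  by move=> i; rewrite ffunE /cell_of !big1 // => x _; rewrite !mul0r.
rewrite /run foldl_rcons -/(run w ops).
case: o => x /=; apply: represents_ext (represents_add _ _ IH) => y;
  rewrite /net -cats1 !count_cat /= eq_sym; case: (x == y); lia.
Qed.

(** The net counts that remain once the stragglers outside [S] have been extracted. *)
Definition restr v S (x : ident n) : int := if x \in S then v x else 0.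

(** Multiplicity exactly one makes the count of the cell equal to the net count of [x], so that one
    extraction clears [x] completely. *)
Definition peelable S :=
  exists i x, [/\ x \in S, mult (hashB w) i x = 1%N &
    forall y, y \in S -> y != x -> mult (hashB w) i y = 0%N].

(** The multiplicity of [x] in the cell is left open here; the priority rule of [step] takes care of
    it. *)
Definition pure_passes v S :=
  forall i x, passes w (cell_of (restr v S) i) x ->
    forall y, y \in S -> y != x -> mult (hashB w) i y = 0%N.

Lemma cell_of_pure v S i x :
    (forall y, y \in S -> y != x -> mult (hashB w) i y = 0%N) ->
  cell_of (restr v S) i =
  let c := restr v S x * (mult (hashB w) i x)%:Z in
  Cell c (c * (x : nat)%:Z) (c * (hashg w x : nat)%:Z).
Proof.
move=> H.
have z y : y != x -> restr v S y * (mult (hashB w) i y)%:Z = 0.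
  rewrite /restr => yx; case: ifP => yS; last by rewrite mul0r.
  by rewrite H // mulr0.
by rewrite /cell_of; congr Cell;
  rewrite (bigD1 x) //= big1 ?addr0 // => y /z ->;
   rewrite ?mul0r.
Qed.

Lemma passesP c x :
  passes w c x <-> [/\ cell_count c != 0,
    cell_idSum c = cell_count c * (x : nat)%:Z
  & cell_hashSum c = cell_count c * (hashg w x : nat)%:Z].
Proof.
have E (a b : int) (e : nat) : b != 0 ->
    (a%:~R / b%:~R == e%:R :> rat) = (a == b * e%:Z).
  move=> b0; rewrite -(eqr_int rat) rmorphM /= mulrC.
  have b0' : b%:~R != 0 :> rat by rewrite intr_eq0.
  by rewrite -(can2_eq (mulVKf b0') (mulKf b0')).
rewrite /passes; split=> [/and3P[c0]|[c0]].
  by rewrite !E // => /eqP ? /eqP ?.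
by move=> /eqP a /eqP b; rewrite c0 !E ?a ?b.
Qed.

Section Good.
Variables (ops : seq (op n)).
Let v := net ops.
Let S0 := [set x | v x != 0].
Hypothesis peel : forall S, S \subset S0 -> S != set0 -> peelable S.
Hypothesis pure : forall S, S \subset S0 -> pure_passes v S.

(** Loop invariant, with [S] the set of stragglers still to be extracted. *)
Definition peel_inv S (s : lstate n m) :=
  [/\ S \subset S0, represents (restr v S) (bloom s),
      recovered s =i S0 :\: S, uniq (stack s)
    & stack s =i [set x in S0 :\: S | 0 < v x]].

Lemma peel_inv_extract S s x :
  x \in S -> peel_inv S s -> peel_inv (S :\ x) (extract w x (v x) s).
Proof.
move=> xS [SS0 rep rec us stk].
have xS0 := subsetP SS0 _ xS.
have vx0 : v x != 0 by move: xS0; rewrite inE.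
have rep' : represents (restr v (S :\ x)) (bloom (extract w x (v x) s)).
  rewrite /extract; case: ltgtP vx0 => // vx _ /=;
    apply: represents_ext (represents_iter _ _ x rep) => y;
    rewrite /restr !inE; case: (y =P x) => [->|_]; rewrite /= ?addr0 //;
    rewrite xS mulr1n; lia.
have rec' : x :: recovered s =i S0 :\: (S :\ x).
  move=> y; rewrite !inE rec !inE; case: (y =P x) => //= ->.
  by move: xS0; rewrite inE => ->.
have S'S0 : S :\ x \subset S0 by apply: subset_trans SS0; apply: subD1set.
split=> //.
- by rewrite /extract; case: ifP.
- rewrite /extract; case: ifP => //= _.
  by rewrite us andbT stk !inE xS.
- move=> y; rewrite /extract; case: ifP => vx /=; rewrite ?inE stk !inE;
    case: (y =P x) => //= ->; rewrite ?xS ?vx ?andbF ?andbT //.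
Qed.

(** Induction on the number of remaining stragglers [S]. While [S] is nonempty, a peelable cell
    passes with multiplicity one, so the loop cannot stop and the priority rule admits only cells of
    multiplicity one. By purity the count of such a cell is [v x], and the step removes [x] from
    [S]. *)
Lemma answers_correctly_good : answers_correctly w ops.
Proof.
rewrite /answers_correctly /list_stragglers_ensures.
have : peel_inv S0 (LState (run w ops) [::] [::]).
  split=> //=; last 2 first.
  - by move=> x; rewrite setDv inE.
  - by move=> x; rewrite setDv !inE.
  apply: represents_ext (represents_run ops) => x.
  by rewrite /restr inE -/v; case: eqP.
move: {2}#|S0| (erefl #|S0|) (LState _ _ _) => c; move: {1 2}S0.
elim: c => [|c IH] S cS s inv; have [SS0 [tot rep] rec us stk] := inv.
  (* With nothing left, all counts in [B] are 0, so no cell passes; the total count is 0 as well,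
     which skips the second loop. *)
  have S_0 : S = set0 by apply/eqP; rewrite -cards_eq0 cS.
  split=> [_|s' [i [x [/passesP[]]]]]; last first.
    by rewrite rep /= big1 ?eqxx // => y _; rewrite /restr S_0 inE mul0r.
  rewrite tot big1 ?eqxx; last by move=> y _; rewrite /restr S_0 inE.
  split; first by move=> x; rewrite rec S_0 setD0.
  apply: uniq_perm; rewrite ?enum_uniq // => x.
  rewrite stk mem_enum S_0 setD0 !inE -/v.
  by case: ltgtP; rewrite ?andbT ?andbF.
have S_0 : S != set0 by rewrite -cards_eq0 cS.
have [i0 [x0 [x0S m0 p0]]] := peel SS0 S_0.
have pass0 : passes w (tabB (bloom s) i0) x0.
  rewrite rep (cell_of_pure v p0) m0 /restr x0S mulr1; apply/passesP.
  by split=> //=; move: (subsetP SS0 _ x0S); rewrite inE.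
split=> [/(_ _) H|s' [i [x [px mx ->]]]].
  case: (H (extract w x0 (cell_count (tabB (bloom s) i0)) s)).
  by exists i0, x0; split=> //; left.
(* The second alternative of [step] is refuted by the passing cell [i0], where [x0] has multiplicity
   one. *)
have {}mx : mult (hashB w) i x = 1%N by case: mx => // /(_ i0 x0 pass0).
move: px; rewrite rep => px; have /cell_of_pure E := pure SS0 px.
move/passesP: px; rewrite E mx mulr1 /= => -[rx _ _].
have xS : x \in S by move: rx; rewrite /restr; case: ifP; rewrite ?eqxx.
rewrite /restr xS; apply: (IH (S :\ x)).
  by move: cS; rewrite (cardsD1 x) xS => -[].
exact: peel_inv_extract.
Qed.

End Good.
End Peeling.

(** * Hash failures *)

Section Events.
Variables (n m k : nat).
Notation ball := ('I_k * ident n)%type.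
Implicit Types (v : ident n -> int) (T : {set ident n}) (V : {set ball}).

Definition balls T : {set ball} := setX setT T.

Lemma card_balls T : #|balls T| = (k * #|T|)%N.
Proof. by rewrite cardsX cardsT card_ord. Qed.

Definition ball_map (hs : {ffun 'I_k -> hash_fun n m}) : {ffun ball -> 'I_m} :=
  [ffun p => hs p.1 p.2].

Lemma ball_map_inj : injective ball_map.
Proof.
move=> f g /ffunP fg; apply/ffunP => l; apply/ffunP => x.
by have := fg (l, x); rewrite !ffunE.
Qed.

(** A singleton fibre of [ball_map] is a cell holding one ball [(l, x)]: this gives multiplicity one
    for [x] and zero for the rest of [T]. *)
Lemma peelable_balls (w : hashes n m k) T :
  ball_map (hashB w) \notin unpeelable _ (balls T) -> peelable w T.
Proof.
rewrite inE negb_forall => /existsP[i]; rewrite negbK => /cards1P[[l x] E].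
have {}E l' y : ((y \in T) && (hashB w l' y == i)) = ((l', y) == (l, x)).
  by have /setP/(_ (l', y)) := E; rewrite !inE ffunE.
have /andP[xT /eqP hx] : (x \in T) && (hashB w l x == i) by rewrite E.
exists i, x; split=> // [|y yT yx].
  apply/eqP/cards1P; exists l; apply/setP => l'; rewrite !inE.
  by have := E l' x; rewrite xT xpair_eqE eqxx andbT.
apply/eqP; rewrite cards_eq0 -subset0; apply/subsetP => l'; rewrite inE.
by have := E l' y; rewrite yT xpair_eqE (negbTE yx) andbF inE => /= ->.
Qed.

(** [V] stands for the balls present in a cell. The condition involves only [V] and [g], so it is
    independent of where the balls land. *)
Definition false_pass v V (g : {ffun ident n -> 'I_(n ^ 2).+1}) : bool :=
  let c := \sum_(p in V) v p.2 in
  [exists x : ident n, [&& c != 0, [exists p in V, p.2 != x],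
    \sum_(p in V) v p.2 * (p.2 : nat)%:Z == c * (x : nat)%:Z
  & \sum_(p in V) v p.2 * (g p.2 : nat)%:Z == c * (g x : nat)%:Z]].

(** The idSum equation does not mention [g], so it fixes the same [x] for all [g]. For a ball [p] of
    another identifier, the hashSum equation is linear in [g p.2], with coefficient [v p.2] times
    the number of balls of [p.2] in [V]. This is nonzero, so one value of [g p.2] at most is
    possible. *)
Lemma card_false_pass v V :
  (forall p, p \in V -> v p.2 != 0) ->
  (#|[set g | false_pass v V g]| * (n ^ 2).+1
     <= #|{ffun ident n -> 'I_(n ^ 2).+1}|)%N.
Proof.
move=> v0; have [->|[g0]] := set_0Vmem [set g | false_pass v V g].
  by rewrite cards0.
rewrite inE => /existsP[x /and4P[c0 /exists_inP[p pV px] /eqP Ex _]].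
rewrite -[X in (_ * X <= _)%N]card_ord.
apply: (@card_mul_le_determined _ _ _ p.2) => g a b.
have solve e : upd g p.2 e \in [set g | false_pass v V g] ->
   \sum_(q in V | q.2 == p.2) v q.2 * (e : nat)%:Z =
   (\sum_(q in V) v q.2) * (g x : nat)%:Z
     - \sum_(q in V | q.2 != p.2) v q.2 * (g q.2 : nat)%:Z.
  rewrite inE => /existsP[y /and4P[_ _ /eqP Ey /eqP H]].
  have xy : y = x.
    by apply/val_inj/eqP; rewrite /= -eqz_nat; apply/eqP/(mulfI c0);
      rewrite -Ey -Ex.
  move: H; rewrite xy ffunE eq_sym (negbTE px) (bigID (fun q => q.2 == p.2)) /=
    => <-.
  under [X in _ + X - _]eq_bigr => q /andP[_ /negbTE qp] do rewrite ffunE qp.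
  rewrite addrK; apply: eq_bigr => q /andP[_ /eqP ->].
  by rewrite ffunE eqxx.
move=> /solve Ha /solve; rewrite -Ha => {Ha solve}.
have Ec (e : 'I_(n ^ 2).+1) : \sum_(q in V | q.2 == p.2) v q.2 * (e : nat)%:Z =
    (v p.2 * (e : nat)%:Z) *+ #|[set q in V | q.2 == p.2]|.
  rewrite -sumr_const; apply: eq_big => [q|q /andP[_ /eqP ->]//].
  by rewrite inE.
rewrite !Ec => /eqP; rewrite eqrMn2r => /orP[|/eqP].
  rewrite cards_eq0 => /eqP/setP/(_ p); by rewrite !inE pV eqxx.
by move/(mulfI (v0 _ pV)) => -[] /val_inj.
Qed.

Lemma sum_restr_mult (w : hashes n m k) v T i (F : ident n -> int) :
  \sum_x restr v T x * (mult (hashB w) i x)%:Z * F x =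
  \sum_(p in [set p in balls T | ball_map (hashB w) p == i]) v p.2 * F p.2.
Proof.
under [RHS]eq_bigl => p do rewrite !inE ffunE.
rewrite -(pair_big_dep predT (fun l x => (x \in T) && (hashB w l x == i))
          (fun _ x => v x * F x)) /=.
under [RHS]eq_bigr => l _ do rewrite big_mkcondr /=.
rewrite exchange_big /= [RHS]big_mkcond /=; apply: eq_bigr => x _.
rewrite /restr; case: ifP => _; last by rewrite !mul0r.
rewrite -big_mkcond /= sumr_const -mulr_natr mulrAC; congr (_ * _).
by rewrite /mult cardsE natz.
Qed.

(** The witness [V] is the set of balls of [T] in the cell. The conclusion only says that [V] lies
    in the cell, which may also hold balls of identifiers extracted earlier. *)
Lemma impure_passes (w : hashes n m k) v T :
  ~ pure_passes w v T -> exists i, exists2 V : {set ball},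
    V \subset balls T & [forall p in V, ball_map (hashB w) p \in [set i]]
                        && false_pass v V (hashg w).
Proof.
move=> /existsNP[i] /existsNP[x] /not_implyP[/passesP[c0 Ex Eg]].
move=> /existsNP[y] /not_implyP[yT] /not_implyP[yx] /eqP my.
exists i, [set p in balls T | ball_map (hashB w) p == i].
  by apply/subsetP => p; rewrite inE => /andP[].
apply/andP; split; first by apply/forall_inP => p; rewrite !inE => /andP[].
have c1 : cell_count (cell_of w (restr v T) i) =
  \sum_(p in [set p in balls T | ball_map (hashB w) p == i]) v p.2.
  have := sum_restr_mult w v T i (fun=> 1).
  by under eq_bigr do rewrite mulr1; under [RHS]eq_bigr do rewrite mulr1.
apply/existsP; exists x; rewrite -c1 c0 /=; apply/and3P; split.
- have /card_gt0P[l] : (0 < mult (hashB w) i y)%N by rewrite lt0n.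
  rewrite inE => hl; apply/exists_inP; exists (l, y) => //.
  by rewrite !inE ffunE yT.
- by rewrite -(sum_restr_mult w v T i (fun x => (x : nat)%:Z)); apply/eqP.
- by rewrite -(sum_restr_mult w v T i (fun x => (hashg w x : nat)%:Z));
    apply/eqP.
Qed.

End Events.

(** * Probability bounds *)

Section Probability.
Variable R : realType.

Definition prob (T : finType) (X : {set T}) : R := #|X|%:R / #|T|%:R.

Lemma prob_ge0 (T : finType) (X : {set T}) : 0 <= prob X.
Proof. by rewrite divr_ge0. Qed.

Lemma le_prob (T : finType) (X Y : {set T}) : X \subset Y -> prob X <= prob Y.
Proof.
by move=> XY; rewrite ler_wpM2r ?invr_ge0 ?ler0n // ler_nat subset_leq_card.
Qed.

Lemma prob_setU (T : finType) (X Y : {set T}) :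
  prob (X :|: Y) <= prob X + prob Y.
Proof.
rewrite -mulrDl ler_wpM2r ?invr_ge0 ?ler0n // -natrD ler_nat.
exact: leq_card_setU.
Qed.

Lemma prob_bigcup (T I : finType) (P : pred I) (F : I -> {set T}) :
  prob (\bigcup_(i | P i) F i) <= \sum_(i | P i) prob (F i).
Proof.
elim/big_rec2: _ => [|i x y _ IH]; first by rewrite /prob cards0 mul0r.
by apply: le_trans (prob_setU _ _) _; rewrite lerD2l.
Qed.

Lemma Pr_ge (T : finType) (P : T -> Prop) (B : {set T}) :
  (0 < #|T|)%N -> (forall w, w \notin B -> P w) -> 1 - prob B <= Pr R P.
Proof.
move=> T0 BP; have T0' : #|T|%:R != 0 :> R by rewrite pnatr_eq0 -lt0n.
have -> : 1 - prob B = prob (~: B).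
  by rewrite /prob [#|~: B|]cardsCs setCK natrB ?max_card // mulrBl divff.
apply: (le_prob (Y := [set w | `[< P w >]])).
by apply/subsetP => w; rewrite !inE => /BP Pw; apply/asboolP.
Qed.

Lemma prob_le (T : finType) (X : {set T}) (a b : nat) : (0 < a)%N ->
  (#|X| * a <= #|T| * b)%N -> prob X <= b%:R / a%:R.
Proof.
move=> a0 H; have [T0|T0] := posnP #|T|.
  by rewrite /prob T0 invr0 mulr0 divr_ge0.
rewrite ler_pdivrMr ?ltr0n // mulrAC ler_pdivlMr ?ltr0n //.
by rewrite -!natrM ler_nat [X in (_ <= X)%N]mulnC.
Qed.

Lemma prob_unpeelable (J A : finType) (D : {set J}) (b : nat) :
  (0 < #|A|)%N -> (2 * b <= #|D|)%N -> (#|D| <= #|A|)%N ->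
  prob (unpeelable A D) <= 2 ^+ #|D| * (#|D|%:R / #|A|%:R) ^+ b.
Proof.
move=> A0 bD DA; rewrite expr_div_n mulrA -!natrX -natrM.
by apply: prob_le (card_unpeelable bD DA); rewrite expn_gt0 A0.
Qed.

Lemma prob_constant (J A : finType) (V : {set J}) (i : A) :
  prob [set f : {ffun J -> A} | [forall p in V, f p \in [set i]]]
    <= #|A|%:R^-1 ^+ #|V|.
Proof.
have A0 : (0 < #|A|)%N by apply/card_gt0P; exists i.
rewrite exprVn -natrX -[leRHS]mul1r.
apply: (@prob_le _ _ _ 1); first by rewrite expn_gt0 A0.
have := @card_confined J A (fun=> [set i]) V 1; rewrite exp1n.
by apply=> // f; rewrite cards1.
Qed.

Lemma prob_false_pass n k v (V : {set 'I_k * ident n}) :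
  (forall p, p \in V -> v p.2 != 0) ->
  prob [set g | false_pass v V g] <= (n ^ 2).+1%:R^-1.
Proof.
move=> v0; rewrite -[leRHS]mul1r; apply: (@prob_le _ _ _ 1) => //.
by rewrite muln1 card_false_pass.
Qed.

(** Independence of the [h_i] and [g]: the choices of [f_1, f_2] cancel, and injectivity of
    [ball_map] bounds the preimage of [P]. *)
Lemma prob_hashes n m k (P : {set {ffun 'I_k * ident n -> 'I_m}})
    (Q : {set {ffun ident n -> 'I_(n ^ 2).+1}}) :
  prob [set w : hashes n m k | (ball_map (hashB w) \in P) && (hashg w \in Q)]
    <= prob P * prob Q.
Proof.
set X := [set w | _].
have -> : X = setX (setX (@ball_map n m k @^-1: P) setT) Q.
  by apply/setP => -[[a b] c]; rewrite !inE andbT.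
rewrite /prob !cardsX !card_prod cardsT !natrM.
have -> : #|{ffun 'I_k -> hash_fun n m}| = #|{ffun 'I_k * ident n -> 'I_m}|.
  by rewrite !card_ffun card_prod !card_ord -expnM mulnC.
have leP : (#|@ball_map n m k @^-1: P| <= #|P|)%N.
  rewrite -(card_imset _ (@ball_map_inj n m k)); apply: subset_leq_card.
  by apply/subsetP => _ /imsetP[f + ->]; rewrite inE.
set c : R := #|{ffun 'I_2 -> _}|%:R; set a : R := #|{ffun 'I_k * _ -> _}|%:R.
set b : R := #|{ffun ident n -> _}|%:R.
(* There are no choices of [f_1, f_2] when [m = 0]; the left side is then 0. *)
have [->|c0] := eqVneq c 0.
  by rewrite !(mulr0, mul0r) !mulr_ge0 ?invr_ge0.
rewrite !invfM (_ : _ * _ = (#|@ball_map n m k @^-1: P|%:R / a) * (#|Q|%:R / b)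
  * (c / c)); last by ring.
rewrite divff // mulr1 ler_wpM2r ?prob_ge0 // ler_wpM2r ?invr_ge0 ?ler0n //.
by rewrite ler_nat.
Qed.

Lemma sum_subsets_card (J : finType) (D : {set J}) (F : nat -> R) :
  \sum_(V in powerset D) F #|V| = \sum_(j < #|D|.+1) F j *+ 'C(#|D|, j).
Proof.
have cD (V : {set J}) : V \in powerset D -> (#|V| < #|D|.+1)%N.
  by rewrite powersetE ltnS; apply: subset_leq_card.
rewrite (partition_big (fun V : {set J} => inord #|V| : 'I_#|D|.+1) predT) //=.
apply: eq_bigr => j _; rewrite -cards_draws -sumr_const.
apply: eq_big => [V|V /andP[/cD VD /eqP <-]]; last by rewrite inordK.
rewrite inE powersetE; apply: andb_id2l; rewrite -powersetE => /cD VD.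
by rewrite -val_eqE /= inordK.
Qed.

(** Union bound over the two kinds of failure. The sets [T] are grouped by size [j]; the subsets [V]
    of the [k * s] balls, weighted by [m ^- #|V|], add up to a binomial expansion. *)
Lemma prob_good_hashes_ge n m k (v : ident n -> int) :
    (0 < m)%N -> (1 < k)%N ->
    let s := #|[set x | v x != 0]| in (k * s <= m)%N ->
  1 - (\sum_(j < s.+1 | (0 < j)%N)
          ((8 * k%:R / m%:R * j%:R) ^+ k./2) ^+ j *+ 'C(s, j)
        + m%:R / (n ^ 2).+1%:R * (1 + m%:R^-1) ^+ (k * s))
  <= Pr R (fun w : hashes n m k =>
     (forall S : {set ident n}, S \subset [set x | v x != 0] ->
        S != set0 -> peelable w S) /\
     (forall S : {set ident n}, S \subset [set x | v x != 0] ->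
        pure_passes w v S)).
Proof.
move=> m0 k1 s ksm; set S0 := [set x | v x != 0].
pose B1 := \bigcup_(T in powerset S0 | T != set0)
  [set w : hashes n m k | (ball_map (hashB w) \in unpeelable 'I_m (balls k T))
     && (hashg w \in [set: {ffun ident n -> 'I_(n ^ 2).+1}])].
pose B2 := \bigcup_(i : 'I_m) \bigcup_(V in powerset (balls k S0))
  [set w : hashes n m k | (ball_map (hashB w) \in
      [set f : {ffun 'I_k * ident n -> 'I_m} | [forall p in V, f p \in [set
        i]]])
    && (hashg w \in [set g | false_pass v V g])].
apply: le_trans (@Pr_ge _ _ (B1 :|: B2) _ _); last 2 first.
- by rewrite !card_prod !card_ffun !card_ord !muln_gt0 !expn_gt0 m0.
- move=> w; rewrite inE negb_or => /andP[wB1 wB2]; split=> S SS0.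
    move=> S_0; apply: peelable_balls; apply: contra wB1 => wS.
    by apply/bigcupP; exists S; rewrite ?powersetE ?SS0 // !inE andbT;
      move: wS; rewrite inE.
  apply: contrapT => /impure_passes[i [V VS /andP[Vi fp]]].
  move/negP: wB2; apply; apply/bigcupP; exists i => //; apply/bigcupP; exists V.
    by rewrite powersetE (subset_trans VS) // setXS.
  by rewrite !inE Vi fp.
rewrite lerD2l lerN2; apply: le_trans (prob_setU _ _) _; apply: lerD.
  apply: le_trans (prob_bigcup _ _) _.
  (* [F] vanishes at 0, which carries the condition [T != set0] over to sizes. *)
  pose F j := if (0 < j)%N then
    ((8 * k%:R / m%:R * j%:R) ^+ k./2) ^+ j : R else 0.
  rewrite [leRHS]big_mkcond (eq_bigr (fun j : 'I_s.+1 => F j *+ 'C(s, j)));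
    last first.
    by move=> j _; rewrite /F; case: ifP; rewrite ?mul0rn.
  rewrite -(sum_subsets_card S0 F) big_mkcondr /=; apply: ler_sum => T.
  rewrite powersetE => TS0; rewrite /F card_gt0; case: ifP => // T0.
  apply: le_trans (prob_hashes _ _) _.
  rewrite {2}/prob cardsT divff ?mulr1; last first.
    by rewrite pnatr_eq0 card_ffun card_ord expn_eq0.
  have Ts : (#|T| <= s)%N by apply: subset_leq_card.
  have kk : (k./2.*2 <= k)%N by rewrite -[leqRHS]odd_double_half leq_addl.
  apply: le_trans (@prob_unpeelable _ _ _ (k./2 * #|T|) _ _ _) _.
  - by rewrite card_ord.
  - by rewrite card_balls mulnA leq_mul2r mul2n kk orbT.
  - by rewrite card_balls card_ord (leq_trans _ ksm) // leq_mul2l Ts orbT.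
  (* Source of the constant 8: the factor [2 ^ (k * #|T|)] is at most [(2 ^ 3) ^ (k./2 * #|T|)],
     since [k] is at least 2. *)
  have k3 : (k <= 3 * k./2)%N.
    have := odd_double_half k; move: k1; rewrite -mul2n; case: (odd k) => /=;
      lia.
  rewrite card_balls card_ord -exprM.
  apply: (@le_trans _ _ ((2 ^+ 3) ^+ (k./2 * #|T|) *
      ((k * #|T|)%:R / m%:R) ^+ (k./2 * #|T|))).
    rewrite ler_wpM2r ?exprn_ge0 ?divr_ge0 // -exprM ler_weXn2l ?ler1n //.
    by rewrite mulnA leq_mul2r k3 orbT.
  rewrite -exprMn natrM; rewrite le_eqVlt; apply/orP; left; apply/eqP;
    congr (_ ^+ _).
  ring.
apply: le_trans (prob_bigcup _ _) _.
have Hi (i : 'I_m) : prob (\bigcup_(V in powerset (balls k S0))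
  [set w : hashes n m k | (ball_map (hashB w) \in
      [set f : {ffun 'I_k * ident n -> 'I_m} | [forall p in V, f p \in [set
        i]]])
    && (hashg w \in [set g | false_pass v V g])]) <=
    (n ^ 2).+1%:R^-1 * (1 + m%:R^-1) ^+ (k * s).
  apply: le_trans (prob_bigcup _ _) _.
  apply: (@le_trans _ _ (\sum_(V in powerset (balls k S0))
            m%:R^-1 ^+ #|V| * (n ^ 2).+1%:R^-1)).
    apply: ler_sum => V; rewrite powersetE => VS.
    apply: le_trans (prob_hashes _ _) _; apply: ler_pM; rewrite ?prob_ge0 //.
      by have := prob_constant V i; rewrite card_ord.
    by apply: prob_false_pass => p /(subsetP VS); rewrite !inE.
  rewrite -big_distrl /= (sum_subsets_card (balls k S0) (fun j => m%:R^-1 ^+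
    j)).
  rewrite mulrC card_balls exprDn.
  by under [X in _ <= _ * X]eq_bigr do rewrite expr1n mul1r.
apply: le_trans (ler_sum _ (fun i _ => Hi i)) _.
by rewrite sumr_const card_ord -[leLHS]mulr_natl mulrA.
Qed.

End Probability.

(** * Numerical estimates *)

Section Numerics.
Variable R : realType.
Notation e := (expR 1 : R).

(** The bound [expR (- 1 / 2) >= 1 / 2] is inverted and squared. The value 4 matches the assumption
    [eps < 1 / 4], which thus yields [ln (1 / eps) >= 1]. *)
Lemma expR1_le4 : e <= 4.
Proof.
have h := expR_ge1Dx (- 2^-1 : R).
have -> : e = (expR 2^-1) ^+ 2 by rewrite -expRM_natl; congr expR; field.
have -> : 4 = 2 ^+ 2 :> R by rewrite -natrX.
rewrite lerXn2r ?nnegrE ?expR_ge0 //.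
rewrite expRN in h; rewrite -[leLHS]invrK -[leRHS]invrK lef_pV2 ?posrE
  ?invr_gt0 ?expR_gt0 //.
by apply: le_trans h; lra.
Qed.

(** The quotient [j ^ j / j!] is a single term of the exponential series at [j]. *)
Lemma expn_le_expR_fact (j : nat) : j%:R ^+ j <= e ^+ j * j`!%:R.
Proof.
case: j => [|j]; first by rewrite !expr0 mul1r.
have := expR_ge1Dxn j (ler0n R j.+1).
rewrite -[X in expR X]mulr1 expRM_natl => h.
rewrite -ler_pdivrMr ?ltr0n ?fact_gt0 //; apply: le_trans h; lra.
Qed.

Lemma bin_mul_fact_le (s j : nat) : ('C(s, j) * j`! <= s ^ j)%N.
Proof.
rewrite bin_ffact; elim: j => [|j IH] //.
by rewrite ffactnSr expnSr leq_mul // leq_subr.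
Qed.

Lemma bin_mul_expn_le (s d j : nat) : (s <= d)%N -> (0 < d)%N ->
  'C(s, j)%:R * (j%:R / d%:R) ^+ j <= e ^+ j.
Proof.
move=> sd d0; have d0' : 0 < d%:R ^+ j :> R by rewrite exprn_gt0 ?ltr0n.
rewrite expr_div_n mulrA ler_pdivrMr //.
apply: le_trans (ler_wpM2l (ler0n _ _) (expn_le_expR_fact j)) _.
rewrite mulrCA ler_wpM2l ?exprn_ge0 ?expR_ge0 // -natrM -natrX ler_nat.
apply: leq_trans (bin_mul_fact_le s j) _.
by case: j {d0'} => // j; rewrite leq_exp2r.
Qed.

Lemma geometric_sum_le (q : R) (s : nat) : 0 <= q -> q <= 2^-1 ->
  \sum_(j < s.+1 | (0 < j)%N) q ^+ j <= 2 * q.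
Proof.
move=> q0 q2; rewrite big_mkcond big_ord_recl /= add0r.
(* The bound is strengthened by the tail [2 * q ^+ s.+1] so that the induction goes through. *)
have H : \sum_(i < s) q ^+ i.+1 + 2 * q ^+ s.+1 <= 2 * q.
  elim: s => [|s IH]; first by rewrite big_ord0 add0r.
  rewrite big_ord_recr /= -addrA; apply: le_trans IH; rewrite lerD2l.
  have : 0 <= q ^+ s.+1 by rewrite exprn_ge0.
  by rewrite [q ^+ s.+2]exprS; move: (q ^+ s.+1) => t t0; nra.
by apply: le_trans H; rewrite lerDl mulr_ge0 ?exprn_ge0.
Qed.

(** From [a <= 1 / (d * e ^ 2)] comes [(a * j) ^ b <= (j / d) ^ b * e ^- (2 * b)]. One factor
    [j / d] is kept: its [j]-th power absorbs the binomial coefficient at the cost of [e ^ j]. A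
    geometric series of ratio [e ^- (2 * b - 1)] remains. *)
Lemma sum_peeling_le (s d b : nat) (a : R) :
    (s <= d)%N -> (0 < d)%N -> (0 < b)%N -> 0 <= a -> a * d%:R * e ^+ 2 <= 1 ->
    e ^- (2 * b).-1 <= 2^-1 ->
  \sum_(j < s.+1 | (0 < j)%N) ((a * j%:R) ^+ b) ^+ j *+ 'C(s, j)
    <= 2 * e ^- (2 * b).-1.
Proof.
move=> sd d0 b0 a0 ad eb; set q := e ^- _ in eb *.
have e0 : 0 < e by rewrite expR_gt0.
have d0' : 0 < d%:R :> R by rewrite ltr0n.
have q0 : 0 <= q by rewrite invr_ge0 exprn_ge0 ?expR_ge0.
apply: le_trans (geometric_sum_le s q0 eb); apply: ler_sum => j j0.
have jd : (j <= d)%N by apply: leq_trans sd; rewrite -ltnS.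
have step : (a * j%:R) ^+ b <= (j%:R / d%:R) * e ^- (2 * b).
  have aj : a * j%:R <= (j%:R / d%:R) * e ^- 2.
    rewrite -mulrA -invfM ler_pdivlMr ?mulr_gt0 ?exprn_gt0 //.
    have -> : a * j%:R * (d%:R * e ^+ 2) = j%:R * (a * d%:R * e ^+ 2) by ring.
    by rewrite -[leRHS]mulr1 ler_wpM2l.
  have {}aj : (a * j%:R) ^+ b <= (j%:R / d%:R * e ^- 2) ^+ b.
    apply: lerXn2r aj; rewrite nnegrE mulr_ge0 ?divr_ge0 //.
    by rewrite invr_ge0 exprn_ge0 ?ltW.
  apply: le_trans aj _; rewrite exprMn exprVn -exprM ler_wpM2r ?invr_ge0
    ?exprn_ge0 ?(ltW e0) //.
  rewrite -{2}[j%:R / _]expr1 ler_wiXn2l ?divr_ge0 //.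
  by rewrite ler_pdivrMr // mul1r ler_nat.
rewrite -mulr_natl.
have step' : ((a * j%:R) ^+ b) ^+ j <= ((j%:R / d%:R) * e ^- (2 * b)) ^+ j.
  apply: lerXn2r step; rewrite nnegrE; first by rewrite exprn_ge0 ?mulr_ge0.
  by rewrite mulr_ge0 ?divr_ge0 // invr_ge0 exprn_ge0 ?ltW.
apply: le_trans (ler_wpM2l (ler0n _ _) step') _.
rewrite exprMn mulrA; apply: le_trans (ler_wpM2r _ (bin_mul_expn_le j sd d0)) _.
  by rewrite exprn_ge0 // invr_ge0 exprn_ge0 ?ltW.
rewrite -exprMn /q -[X in e ^- X]prednK ?muln_gt0 // exprS invfM mulrA divff
  ?mul1r //.
by rewrite gt_eqF.
Qed.

Lemma natr_absz_ceil (x : R) : 0 < x ->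
  x <= `|Num.ceil x|%N%:R /\ `|Num.ceil x|%N%:R <= x + 1.
Proof.
move=> x0; have c0 : 0 <= Num.ceil x.
  by apply: ltW; rewrite -(ltr_int R); apply: lt_le_trans x0 (ceil_ge x).
rewrite natr_absz ger0_norm //; split; first exact: ceil_ge.
by have := gt_pred_ceil x; lra.
Qed.

End Numerics.

(** * The failure probability *)

Lemma one_le_lnV (R : realType) (eps : R) : 0 < eps -> eps < 4^-1 -> 1 <= ln
  eps^-1.
Proof.
move=> e0 e4; rewrite -ler_expR lnK ?posrE ?invr_gt0 //.
apply: le_trans (expR1_le4 R) _;
  rewrite -[leLHS]invrK lef_pV2 ?posrE ?invr_gt0 //.
exact: ltW.
Qed.

(** With [b = k./2] and [L = ln (1 / eps) >= 1], the exponent satisfies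
    [2 * b - 1 >= k - 2 >= 4 * L - 2 >= 2 * L]. So the ratio is at most [eps ^ 2], hence at most
    [eps / 4]. *)
Lemma peeling_failure_le (R : realType) (eps : R) (s d k m : nat) :
    0 < eps -> eps < 4^-1 -> (0 < m)%N -> (s <= d)%N -> (0 < d)%N ->
    4 * ln eps^-1 <= k%:R -> 8 * k%:R * d%:R * expR 1 ^+ 2 <= m%:R :> R ->
  \sum_(j < s.+1 | (0 < j)%N) ((8 * k%:R / m%:R * j%:R) ^+ k./2) ^+ j *+ 'C(s,
    j)
    <= eps / 2.
Proof.
move=> e0 e4 m0 sd d0 kL kdm; have L1 := one_le_lnV e0 e4.
have k4 : (4 <= k)%N by rewrite -(ler_nat R); lra.
have m0' : 0 < m%:R :> R by rewrite ltr0n.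
have q : expR 1 ^- (2 * k./2).-1 <= eps / 4.
  apply: (@le_trans _ _ (eps ^+ 2)); last by rewrite expr2; nra.
  rewrite -[leRHS]invrK lef_pV2 ?posrE ?exprn_gt0 ?expR_gt0 ?invr_gt0
    ?exprn_gt0 //.
  rewrite -exprVn -[eps^-1]lnK ?posrE ?invr_gt0 // -!expRM_natl ler_expR mulr1.
  apply: (@le_trans _ _ (k%:R - 2)); first by lra.
  rewrite -natrB ?ler_nat; last by lia.
  by have := odd_double_half k; rewrite -mul2n; case: (odd k) => /=; lia.
apply: le_trans (sum_peeling_le _ _ _ _ _ _) _; [exact: sd|exact: d0|..].
- by lia.
- by rewrite divr_ge0 ?mulr_ge0.
- have -> : 8 * k%:R / m%:R * d%:R * expR 1 ^+ 2
    = 8 * k%:R * d%:R * expR 1 ^+ 2 / m%:R :> R by ring.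
  by rewrite ler_pdivrMr // mul1r.
- by lra.
- by lra.
Qed.

(** As [N <= m], the power is at most [expR (N / m) <= e]; the range of [g] then outweighs the
    number of cells, bounded by [C]. *)
Lemma false_pass_failure_le (R : realType) (eps C : R) (n m N : nat) :
    0 <= C -> (0 < m)%N -> (N <= m)%N -> m%:R <= C ->
    expR 1 * C <= eps / 2 * n%:R ^+ 2 -> 0 < eps ->
  m%:R / (n ^ 2).+1%:R * (1 + m%:R^-1) ^+ N <= eps / 2.
Proof.
move=> C0 m0 Nm mC eC e0; have m0' : 0 < m%:R :> R by rewrite ltr0n.
have le1 : (1 + m%:R^-1) ^+ N <= expR 1 :> R.
  apply: (@le_trans _ _ (expR m%:R^-1 ^+ N)).
    apply: lerXn2r (expR_ge1Dx _); rewrite nnegrE ?expR_ge0 //.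
    by rewrite addr_ge0 ?invr_ge0.
  rewrite -expRM_natl ler_expR ler_pdivrMr // mul1r ler_nat //.
rewrite mulrAC ler_pdivrMr ?ltr0n //.
have E0 : 0 <= expR 1 :> R by rewrite expR_ge0.
apply: le_trans (ler_pM _ _ mC le1) _;
  rewrite ?exprn_ge0 ?addr_ge0 ?invr_ge0 //.
rewrite mulrC; apply: le_trans eC _; rewrite ler_wpM2l ?divr_ge0 ?(ltW e0) //.
by rewrite -natrX ler_nat.
Qed.

(* The size assumption d << n is quantified by the bound on d * ln (1 / eps),
   i.e. on the number of cells: it has to be small compared with eps times the
   size of the range [0, n ^ 2] of g.  The bound holds, up to the constant, as
   soon as d <= delta * eps * n. *)
Theorem theorem4 (R : realType) :
  exists cm ck delta : R, [/\ 0 < cm, 0 < ck, 0 < delta &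
    forall (eps : R) (n d : nat),
      0 < eps -> eps < 4^-1 -> (0 < d)%N ->
      d%:R * ln (eps^-1) <= delta * eps * n%:R ^+ 2 ->
      forall ops : seq (op n),
        (#|[set x : ident n | net ops x != 0]| <= d)%N ->
        1 - eps <= Pr R (fun w : hashes n (table_size cm d eps)
                                          (hash_number ck eps) =>
                           answers_correctly w ops)].
Proof.
have e0 : 0 < expR 1 :> R by rewrite expR_gt0.
have e1 : 1 <= expR 1 :> R by have := expR_ge1Dx (1 : R); lra.
(* Since [k <= 4 * L + 1 <= 5 * L], the requirement [8 * k * d * e ^ 2 <= m] is met with
   [8 * 5 = 40]. *)
pose cm : R := 40 * expR 1 ^+ 2;
  have cm0 : 0 < cm by rewrite mulr_gt0 ?exprn_gt0.
(* Chosen so that [C = (cm + 1) * d * L], which bounds [m] after rounding up, satisfies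
   [e * C <= eps / 2 * n ^ 2]. *)
pose delta : R := (2 * expR 1 * (cm + 1))^-1.
have den0 : 0 < 2 * expR 1 * (cm + 1) by rewrite !mulr_gt0 // addr_gt0.
have delta0 : 0 < delta by rewrite invr_gt0.
exists cm, 4, delta; split=> // eps n d eps0 eps4 d0 hd ops sd.
have L1 := one_le_lnV eps0 eps4.
set L := ln eps^-1 in hd L1.
have d1 : 1 <= d%:R :> R by rewrite ler1n.
have dL1 : 1 <= d%:R * L by rewrite -[leLHS]mul1r ler_pM.
set m := table_size cm d eps; set k := hash_number 4 eps.
have [kL Lk] : 4 * L <= k%:R /\ k%:R <= 4 * L + 1 :> R.
  by apply: natr_absz_ceil; lra.
have [mL Lm] : cm * d%:R * L <= m%:R /\ m%:R <= cm * d%:R * L + 1 :> R.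
  by apply: natr_absz_ceil; rewrite -mulrA mulr_gt0 //; lra.
have m0 : (0 < m)%N.
  by rewrite -(ltr0n R); apply: lt_le_trans mL; rewrite -mulrA mulr_gt0 //; lra.
have k1 : (1 < k)%N by rewrite -(ltr_nat R); lra.
have kdm : 8 * k%:R * d%:R * expR 1 ^+ 2 <= m%:R :> R.
  apply: le_trans mL.
  have -> : 8 * k%:R * d%:R * expR 1 ^+ 2 = (8 * d%:R * expR 1 ^+ 2) * k%:R :>
    R by ring.
  have -> : cm * d%:R * L = (8 * d%:R * expR 1 ^+ 2) * (5 * L) by rewrite /cm;
    ring.
  apply: ler_wpM2l; last by lra.
  by rewrite mulr_ge0 ?exprn_ge0 ?mulr_ge0 ?(ltW e0).
set s := #|_| in sd.
have ksm : (k * s <= m)%N.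
  apply: (@leq_trans (k * d)); first by rewrite leq_mul2l sd orbT.
  rewrite -(ler_nat R) natrM; apply: le_trans kdm.
  have kd0 : 0 <= k%:R * d%:R :> R by rewrite mulr_ge0.
  have e2 : 1 <= expR 1 ^+ 2 :> R by rewrite exprn_ege1.
  by rewrite -(mulrA 8); move: (k%:R * d%:R) (expR 1 ^+ 2) kd0 e2 => x y; nra.
apply: (@le_trans _ _ (Pr R (fun w : hashes n m k =>
     (forall S : {set ident n}, S \subset [set x | net ops x != 0] ->
        S != set0 -> peelable w S) /\
     (forall S : {set ident n}, S \subset [set x | net ops x != 0] ->
        pure_passes w (net ops) S)))); last first.
  apply: le_prob; apply/subsetP => w; rewrite !inE => /asboolP[peel pure].
  by apply/asboolP; apply: answers_correctly_good.
apply: le_trans (prob_good_hashes_ge _ m0 k1 ksm); rewrite lerD2l lerN2.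
rewrite [leRHS](_ : _ = eps / 2 + eps / 2); last by field.
apply: lerD; first exact: (peeling_failure_le eps0 eps4 m0 sd d0 kL kdm).
apply: (@false_pass_failure_le _ _ ((cm + 1) * (d%:R * L))) => //.
- by rewrite mulr_ge0 //; lra.
- by apply: le_trans Lm _; lra.
have -> : eps / 2 * n%:R ^+ 2 =
    expR 1 * (cm + 1) * (delta * eps * n%:R ^+ 2).
  by rewrite /delta; field; rewrite !gt_eqF // addr_gt0.
by rewrite mulrA ler_wpM2l // mulr_ge0 ?ltW // addr_gt0.
Qed.
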